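(* Let $K$ be a knot type in $\mathbb{R}^3$. For every $L\ge m_K$, the inclusion $P_L(K)\hookrightarrow Y_L(K)$ is a strong deformation retract. In particular two points of $P_L(K)$ are joined by a path in $Y_L(K)$ if and only if they are joined by a fixed-length thick isotopy inside $P_L(K)$, i.e. by a path in $P_L(K)$.
   Context: Knot types are tame types of knots (one component) in Euclidean $\mathbb{R}^3$. For an embedded closed $C^{1,1}$ curve $\gamma$ ($C^1$ with Lipschitz unit tangent), $\operatorname{Len}(\gamma)$ is the length and the thickness $\operatorname{Thi}(\gamma)$ is the reach of its image, i.e. the supremum of $r>0$ for which the closed $r$-neighbourhood is an embedded solid torus that is the union of the closed normal discs of radius $r$; equivalently, $\operatorname{Thi}(\gamma)$ is the infimum of the radii of circles through three distinct points of $\gamma$. The minimal ropelength is $m_K=\inf\{\operatorname{Len}(\gamma)/\operatorname{Thi}(\gamma):[\gamma]=K\}$. Represent configurations by constant-speed $C^{1,1}$ embeddings $\gamma:S^1=\mathbb{R}/2\pi\mathbb{Z}\to\mathbb{R}^3$, and identify two of them when they differ by an orientation-preserving Euclidean isometry and a rotation or reflection of the source circle. For $m_K\le\Lambda<\infty$, $$Y_\Lambda(K)=\{[\gamma]:\gamma\text{ has knot type }K,\ \operatorname{Thi}(\gamma)\ge1,\ \operatorname{Len}(\gamma)\le\Lambda\},$$ topologised as a quotient of the constant-speed $C^1$ topology. For $L\ge m_K$ the exact-length shell is $P_L(K)=\{[\gamma]\in Y_L(K):\operatorname{Len}(\gamma)=L\}$ with the subspace topology. *)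

(* Defs.v *)
From HB Require Import structures.
From mathcomp Require Import all_boot all_order all_algebra.
From mathcomp Require Import generic_quotient.
From mathcomp Require Import all_classical all_reals all_analysis.
From mathcomp Require Import homotopy.
Set Implicit Arguments.
Unset Strict Implicit.
Unset Printing Implicit Defensive.
Import Order.TTheory GRing.Theory Num.Theory.
Import numFieldNormedType.Exports.
Local Open Scope classical_set_scope.
Local Open Scope ring_scope.
Local Open Scope quotient_scope.

Definition unit_interval (R : realType) : Type := `[(0 : R), 1]%classic.

Section unit_interval.
Variable R : realType.
Local Notation I := (unit_interval R).

HB.instance Definition _ :=
  Topological.copy I (`[(0 : R), 1]%classic : Type).

Lemma in_unit_interval0 : (0 : R) \in (`[0, 1]%classic : set R).
Proof. by rewrite inE /= in_itv /= lexx ler01. Qed.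

Lemma in_unit_interval1 : (1 : R) \in (`[0, 1]%classic : set R).
Proof. by rewrite inE /= in_itv /= lexx ler01. Qed.

Definition I0 : I := exist _ 0 in_unit_interval0.
Definition I1 : I := exist _ 1 in_unit_interval1.

Lemma unit_interval_neq01 : I0 != I1.
Proof.
by apply/eqP => /(congr1 val) /= /eqP; rewrite eq_sym oner_eq0.
Qed.

HB.instance Definition _ := isBiPointed.Build I unit_interval_neq01.

End unit_interval.

Definition strong_deformation_retract (R : realType) (Y : topologicalType)
    (A : set Y) : Prop :=
  exists H : Y * unit_interval R -> Y,
    [/\ continuous H,
        forall y, H (y, zero) = y,
        forall y, A (H (y, one))
      & forall a s, A a -> H (a, s) = a].

(* The library norm on ['rV_3] is the sup norm: it is used for the topology and
   for Lipschitz continuity, where the choice of norm is immaterial, whereas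
   lengths and distances use [enorm]. *)
Definition enorm (R : realType) (x : 'rV[R]_3) : R :=
  Num.sqrt (\sum_(i < 3) x 0 i ^+ 2).

(* A map from the circle R / 2 pi Z is a 2 pi-periodic map on R. *)

Section knots.
Variable R : realType.
Local Notation E := 'rV[R]_3.
Local Notation I := (unit_interval R).
Implicit Types (g h k : R -> E) (A B : set E) (K : set (set E)).

Definition simple_closed g : Prop :=
  [/\ continuous g, periodic g (pi *+ 2)
    & {in `[0, pi *+ 2[ &, injective g}].

Definition knot A : Prop := exists2 g, simple_closed g & A = range g.

(* [H] and [G] are inverse level-preserving homeomorphisms of R^3 x [0, 1]. *)
Definition ambient_isotopic A B : Prop :=
  exists H G : E * I -> E,
    [/\ continuous H /\ continuous G,
        forall s, cancel (fun x => H (x, s)) (fun x => G (x, s)),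
        forall s, cancel (fun x => G (x, s)) (fun x => H (x, s)),
        forall x, H (x, zero) = x
      & [set H (x, one) | x in A] = B].

Definition segment (x y : E) : set E :=
  [set (1 - s) *: x + s *: y | s in `[0, 1]].

Definition polygonal A : Prop :=
  exists s : seq (E * E), A = \bigcup_(xy in [set` s]) segment xy.1 xy.2.

Definition tame_knot A : Prop :=
  knot A /\ exists B, [/\ knot B, polygonal B & ambient_isotopic A B].

(* Knots are unoriented subsets of R^3; a knot and its mirror image may have
   different types. *)
Definition knot_type K : Prop :=
  exists2 A, tame_knot A & K = [set B | ambient_isotopic A B].

Definition unit_tangent g (t : R) : E :=
  (enorm (derive1 g t))^-1 *: derive1 g t.

Definition C11_embedded g : Prop :=
  [/\ simple_closed g,
      forall t, derivable g t 1,
      continuous (derive1 g),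
      forall t, derive1 g t != 0
    & lipschitz (unit_tangent g)].

Definition constant_speed g : Prop :=
  exists v, forall t, enorm (derive1 g t) = v.

Definition len g : R :=
  \int[lebesgue_measure]_(t in `[0, pi *+ 2]) enorm (derive1 g t).

Definition nearest A (x a : E) : Prop :=
  A a /\ forall b, A b -> enorm (x - a) <= enorm (x - b).

(* Federer's reach: the supremum of the radii [r] such that every point at
   distance less than [r] from [A] has a unique nearest point in [A]. *)
Definition reach A : \bar R :=
  ereal_sup [set r%:E | r in [set r : R | 0 < r /\
    forall x, (exists2 a, A a & enorm (x - a) < r) ->
      exists! a, nearest A x a]].

Definition thickness g : \bar R := reach (range g).

Definition min_ropelength K : \bar R :=
  ereal_inf [set ((len g)%:E / thickness g)%E
            | g in [set g | C11_embedded g /\ K (range g)]].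

Definition thick_curves K (L : R) : set (R -> E) :=
  [set g | [/\ C11_embedded g /\ constant_speed g,
               K (range g),
               (1 <= thickness g)%E
             & len g <= L]].

Definition C1_jet (S : set (R -> E)) (g : S) :
    {uniform R -> E} * {uniform R -> E} :=
  (val g, derive1 (val g)).

Definition thick_space K L : topologicalType :=
  initial_topology (@C1_jet (thick_curves K L)).

(* Row vectors: the isometry is x |-> x Q + b, and the change of parameter is
   t |-> +- t + a. *)
Definition same_config g h : Prop :=
  exists (Q : 'M[R]_3) (b : E) (e : bool) (a : R),
    [/\ Q *m Q^T = 1%:M, \det Q = 1
      & forall t, h t = g ((-1) ^+ e * t + a) *m Q + b].

Lemma same_config_refl g : same_config g g.
Proof.
exists 1%:M, 0, false, 0; split; rewrite ?trmx1 ?mulmx1 ?det1// => t.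
by rewrite expr0 mul1r !addr0 mulmx1.
Qed.

Lemma same_config_sym g h : same_config g h -> same_config h g.
Proof.
move=> [Q [b [e [a [QQ dQ hE]]]]].
have QQ' : Q^T *m Q = 1%:M by exact: mulmx1C.
exists Q^T, (- b *m Q^T), e, (- ((-1) ^+ e * a)); split.
- by rewrite trmxK.
- by rewrite det_tr.
- move=> t; rewrite hE mulmxDl -mulmxA QQ mulmx1 mulNmx addrK.
  by rewrite mulrBr !mulrA -signr_addb addbb !mul1r subrK.
Qed.

Lemma same_config_trans g h k :
  same_config g h -> same_config h k -> same_config g k.
Proof.
move=> [Q [b [e [a [QQ dQ hE]]]]] [Q' [b' [e' [a' [QQ' dQ' kE]]]]].
exists (Q *m Q'), (b *m Q' + b'), (e (+) e'), ((-1) ^+ e * a' + a); split.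
- by rewrite trmx_mul mulmxA -(mulmxA Q) QQ' mulmx1.
- by rewrite det_mulmx dQ dQ' mulr1.
- move=> t; rewrite kE hE mulmxDl mulmxA addrA.
  by rewrite mulrDr mulrA -signr_addb addrA.
Qed.

Section quotient.
Variables (K : set (set E)) (L : R).
Local Notation X := (thick_space K L).

Definition same_config_rel : rel X :=
  fun g h : X => `[< same_config (val g) (val h) >].

Lemma same_config_equiv : equiv_class_of same_config_rel.
Proof.
split.
- by move=> g; apply/asboolP; exact: same_config_refl.
- by move=> g h; apply/asboolP/asboolP => /same_config_sym.
- move=> h g k /asboolP gh /asboolP hk.
  by apply/asboolP; exact: same_config_trans gh hk.
Qed.

Canonical same_config_equiv_rel := EquivRelPack same_config_equiv.

Definition thick_configs : topologicalType :=
  quotient_topology {eq_quot same_config_equiv_rel}.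

Definition config_class (g : X) : thick_configs :=
  \pi_({eq_quot same_config_equiv_rel}) g.

(* As a type, it carries the subspace topology. *)
Definition length_shell : set thick_configs :=
  [set config_class g | g in [set g : X | len (val g) = L]].

End quotient.
End knots.

Arguments strong_deformation_retract R {Y} A.
Arguments length_shell {R} K L _.

(* Main.v *)
Require Import Defs.
From mathcomp Require Import all_boot all_order all_algebra.
From mathcomp Require Import generic_quotient.
From mathcomp Require Import all_classical all_reals all_analysis.
From mathcomp Require Import homotopy.
From mathcomp Require Import lra.
Set Implicit Arguments.
Unset Strict Implicit.
Unset Printing Implicit Defensive.
Import Order.TTheory GRing.Theory Num.Theory.
Import numFieldNormedType.Exports.
Local Open Scope classical_set_scope.
Local Open Scope ring_scope.
Local Open Scope quotient_scope.

(* Rescaling by a factor at least 1 keeps the knot type and does not decrease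
   the thickness, so [([g], s) |-> [((1 - s) + s L / len g) g]] stretches every
   class of length at most [L] to length [L] without leaving the space of thick
   classes, and fixes the classes of length [L].  It is well defined because
   length is invariant under isometries and reparametrisations, and continuous
   because constant-speed curves satisfy [len g = 2 pi |g'(0)|]. *)

(** * The Euclidean norm compared with the sup norm *)

Section enorm.
Variable R : realType.
Local Notation E := 'rV[R]_3.

Lemma enormZ (c : R) (x : E) : enorm (c *: x) = `|c| * enorm x.
Proof.
rewrite /enorm -sqrtr_sqr -sqrtrM ?sqr_ge0//; congr Num.sqrt.
by rewrite mulr_sumr; apply: eq_bigr => i _; rewrite mxE exprMn.
Qed.

Lemma enorm_ge0 (x : E) : 0 <= enorm x.
Proof. exact: sqrtr_ge0. Qed.

(** One squared coordinate is at most the sum of all three. Through this bound, constant Euclidean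
    speed controls the derivative in the sup norm. *)
Lemma norm_le_enorm (x : E) : `|x| <= enorm x.
Proof.
rewrite [leLHS]/Num.Def.normr/= mx_normrE; apply: bigmax_le => [|[i j] _ /=].
  exact: enorm_ge0.
rewrite (ord1 i) -sqrtr_sqr ler_wsqrtr// (bigD1 j)//= lerDl.
by apply: sumr_ge0 => k _; exact: sqr_ge0.
Qed.

Lemma enorm_eq0 (x : E) : (enorm x == 0) = (x == 0).
Proof.
apply/eqP/eqP => [x0|->].
  by apply/eqP; rewrite -normr_le0 (le_trans (norm_le_enorm x))// x0.
by rewrite -(scale0r 0) enormZ normr0 mul0r.
Qed.

Lemma enorm_isometry (Q : 'M[R]_3) (x : E) :
  Q *m Q^T = 1%:M -> enorm (x *m Q) = enorm x.
Proof.
have enormE (y : E) : enorm y = Num.sqrt ((y *m y^T) 0 0).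
  by rewrite /enorm mxE; congr Num.sqrt; apply: eq_bigr => i _; rewrite mxE.
by move=> QQ; rewrite !enormE trmx_mul mulmxA -(mulmxA x) QQ mulmx1.
Qed.

Lemma enorm_continuous : continuous (@enorm R).
Proof.
move=> x; rewrite /enorm; apply: continuous_comp; last exact: sqrt_continuous.
apply: continuous_big => [|i _ {}x]; first exact: add_continuous.
apply: (@continuous_comp _ _ _ (fun y : E => y 0 i) (fun y : R => y ^+ 2)).
  exact: coord_continuous.
exact: exprn_continuous.
Qed.

End enorm.

(** * Closed curves under rescaling *)

Section curves.
Variable R : realType.
Local Notation E := 'rV[R]_3.
Implicit Types (g h : R -> E) (A B : set E) (K : set (set E)) (c : R).

(** The extreme value theorem bounds one period, and subtracting [floor (t / T)] periods moves any
    [t] into it. *)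
Lemma periodic_bounded g (T : R) :
  0 < T -> continuous g -> periodic g T -> exists M, forall t, `|g t| <= M.
Proof.
move=> T0 cg pg.
have cng : {within `[0, T], continuous (fun t => `|g t|)}.
  by apply: continuous_subspaceT => t; apply: continuous_comp;
     [exact: cg | exact: norm_continuous].
have [m _ mP] := EVT_max (ltW T0) cng.
exists `|g m| => t.
have periodicz (n : int) (a : R) : g (a + n%:~R * T) = g a.
  case: n => n; first by rewrite -pmulrn mulr_natl periodicn.
  rewrite NegzE mulrNz -pmulrn mulNr mulr_natl.
  by rewrite -(periodicn pg n.+1) subrK.
have := floor_itv (t / T).
set n := Num.floor _ => /andP[].
rewrite ler_pdivlMr// ltr_pdivrMr// => nt tn.
rewrite -(periodicz (- n)); apply: mP.
by rewrite in_itv/= mulrNz mulNr; move: tn; rewrite intrD mulrDl mul1r; lra.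
Qed.

Lemma derivableZ_curve g c : (forall t, derivable g t 1) ->
  forall t, derivable (c \*: g) t 1.
Proof. by move=> dg t; apply: derivableZ; exact: dg. Qed.

Lemma derive1Z_curve g c : (forall t, derivable g t 1) ->
  derive1 (c \*: g) = c \*: derive1 g.
Proof.
by move=> dg; apply/funext => t; rewrite /= !derive1E (deriveZ _ (dg t)).
Qed.

Lemma simple_closedZ g c : c != 0 -> simple_closed g -> simple_closed (c \*: g).
Proof.
move=> c0 [cg pg ig]; split.
- by move=> t; apply: continuousZl_tmp; exact: cg.
- by move=> t /=; rewrite pg.
- by move=> s t si ti /= /(scalerI c0); exact: ig.
Qed.

Lemma C11_embeddedZ g c : 0 < c -> C11_embedded g -> C11_embedded (c \*: g).
Proof.
move=> c0 [sg dg cdg ndg lg]; have cn0 := lt0r_neq0 c0; split.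
- exact: simple_closedZ.
- exact: derivableZ_curve.
- by rewrite (derive1Z_curve _ dg) => t; apply: continuousZl_tmp; exact: cdg.
- by move=> t; rewrite (derive1Z_curve _ dg) /= scaler_eq0 negb_or cn0 ndg.
- suff -> : unit_tangent (c \*: g) = unit_tangent g by exact: lg.
  apply/funext => t; rewrite /unit_tangent (derive1Z_curve _ dg) /=.
  by rewrite enormZ gtr0_norm// scalerA invfM mulrAC mulVf// mul1r.
Qed.

Lemma constant_speedZ g c : (forall t, derivable g t 1) ->
  constant_speed g -> constant_speed (c \*: g).
Proof.
move=> dg [v gv]; exists (`|c| * v) => t.
by rewrite (derive1Z_curve _ dg) /= enormZ gv.
Qed.

(** The integrand is constant. Length thus becomes an evaluation of the derivative at a single
    point, which makes its continuity in the C1 topology accessible. *)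
Lemma len_constant_speed g : constant_speed g ->
  len g = enorm (derive1 g 0) * (pi *+ 2).
Proof.
move=> [v gv]; rewrite /len.
under eq_Rintegral do rewrite gv.
rewrite Rintegral_cst//= lebesgue_measure_itv/= lte_fin.
by rewrite mulrn_wgt0 ?pi_gt0//= subr0 gv.
Qed.

Lemma lenZ g c : 0 <= c -> (forall t, derivable g t 1) -> constant_speed g ->
  len (c \*: g) = c * len g.
Proof.
move=> c0 dg sg.
rewrite (len_constant_speed (constant_speedZ c dg sg)) (len_constant_speed sg).
by rewrite (derive1Z_curve _ dg) /= enormZ ger0_norm// mulrA.
Qed.

Lemma len_gt0 g : C11_embedded g -> constant_speed g -> 0 < len g.
Proof.
move=> [_ _ _ ndg _] /len_constant_speed ->.
rewrite mulr_gt0//; last by rewrite mulrn_wgt0 ?pi_gt0.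
by rewrite lt_neqAle enorm_ge0 eq_sym enorm_eq0 ndg.
Qed.

(** * Ambient isotopy and knot type *)

Lemma unit_interval_itv (s : unit_interval R) : 0 <= \val s <= 1.
Proof. by have := set_valP s; rewrite /= in_itv. Qed.

(** Both isotopies run simultaneously, composed level by level, so no concatenation in time is
    required. *)
Lemma ambient_isotopic_trans A B C :
  ambient_isotopic A B -> ambient_isotopic B C -> ambient_isotopic A C.
Proof.
move=> [H [G [[cH cG] HK GK H0 HAB]]] [H' [G' [[cH' cG'] HK' GK' H0' HBC]]].
have continuous_track (F F' : E * unit_interval R -> E) :
    continuous F -> continuous F' -> continuous (fun z => F' (F z, z.2)).
  move=> cF cF' z; apply: (@continuous_comp _ _ _ (fun z => (F z, z.2)) F').
    apply: (@cvg_pair _ _ _ (nbhs z) (nbhs (F z)) (nbhs z.2)).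
      exact: cF.
    exact: cvg_snd.
  exact: cF'.
exists (fun z => H' (H z, z.2)), (fun z => G (G' z, z.2)); split.
- by split; [exact: continuous_track cH cH' | exact: continuous_track cG' cG].
- by move=> s x /=; rewrite HK' HK.
- by move=> s x /=; rewrite GK GK'.
- by move=> x /=; rewrite H0 H0'.
- by rewrite -HBC -HAB image_comp.
Qed.

(** The homotheties of ratio [1 - s + s * c] lead from the identity to scaling by [c]; every ratio
    is positive, hence invertible. *)
Lemma ambient_isotopic_scale A c : 0 < c ->
  ambient_isotopic A [set c *: x | x in A].
Proof.
move=> c0; pose k (s : unit_interval R) := 1 - \val s + \val s * c.
have k_gt0 s : 0 < k s.
  have /andP[s0 s1] := unit_interval_itv s.
  (* At [s = 1] positivity comes from [c]; elsewhere it comes from [1 - s]. *)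
  rewrite /k; have [->|sn1] := eqVneq (\val s) 1.
    by rewrite subrr add0r mul1r.
  by apply: ltr_pwDl; rewrite ?subr_gt0 ?lt_neqAle ?sn1// mulr_ge0// ltW.
have ck : continuous k.
  move=> s; apply: (@continuous_comp _ _ _ (\val : unit_interval R -> R)
    (fun u : R => 1 - u + u * c)).
    exact: initial_continuous.
  apply: cvgD; last by apply: cvgMl; exact: cvg_id.
  by apply: cvgB; [exact: cvg_cst|exact: cvg_id].
exists (fun z => k z.2 *: z.1), (fun z => (k z.2)^-1 *: z.1); split.
- split => z.
    apply: cvgZ; last exact: cvg_fst.
    by apply: continuous_comp; [exact: cvg_snd|exact: ck].
  apply: cvgZ; last exact: cvg_fst.
  apply: cvgV; first by rewrite gt_eqF.
  by apply: continuous_comp; [exact: cvg_snd|exact: ck].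
- by move=> s x /=; rewrite scalerA mulVf ?scale1r ?gt_eqF.
- by move=> s x /=; rewrite scalerA mulfV ?scale1r ?gt_eqF.
- by move=> x; rewrite /k /= subr0 mul0r addr0 scale1r.
- by congr image; apply/funext => x; rewrite /k/= subrr add0r mul1r.
Qed.

Lemma knot_typeZ K A c : knot_type K -> 0 < c -> K A ->
  K [set c *: x | x in A].
Proof.
move=> [B _ ->] c0 BA.
by apply: ambient_isotopic_trans BA _; exact: ambient_isotopic_scale.
Qed.

(** * Nearest points and reach under dilation *)

Lemma nearestZ A c x a : 0 < c ->
  nearest [set c *: y | y in A] x a <-> nearest A (c^-1 *: x) (c^-1 *: a).
Proof.
move=> c0; have cn0 := lt0r_neq0 c0.
have enormB y : enorm (c^-1 *: x - c^-1 *: y) = c^-1 * enorm (x - y).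
  by rewrite -scalerBr enormZ gtr0_norm ?invr_gt0.
split=> [[[b Ab <-{a}] na]|[Aa na]]; split.
- by rewrite scalerA mulVf// scale1r.
- move=> y Ay; rewrite enormB.
  have := na (c *: y); rewrite -(ler_pM2l (x := c^-1)) ?invr_gt0//.
  rewrite -[c^-1 * enorm (x - c *: y)]enormB scalerA mulVf// scale1r.
  by apply; exists y.
- by exists (c^-1 *: a) => //; rewrite scalerA mulfV// scale1r.
- move=> _ [y Ay <-]; have := na _ Ay.
  rewrite -[in X in _ <= enorm (_ - X) -> _](scale1r y) -(mulVf cn0) -scalerA.
  by rewrite !enormB ler_pM2l// invr_gt0.
Qed.

(** A radius [r] admissible for [A] stays admissible for its dilate: a point within [r] of the
    dilate, divided by [c], lies within [r / c <= r] of [A], and nearest points correspond by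
    [nearestZ]. *)
Lemma reachZ_ge A c : 1 <= c -> (reach A <= reach [set c *: x | x in A])%E.
Proof.
move=> c1; have c0 : 0 < c by exact: lt_le_trans c1.
have cn0 := lt0r_neq0 c0.
apply: ge_ereal_sup => _ [r [r0 rP] <-].
apply: ereal_sup_ubound; exists r => //; split=> // x [_ [a Aa <-] xa].
have [|b [nb ub]] := rP (c^-1 *: x).
  exists a => //; apply: le_lt_trans xa.
  rewrite -[X in x - X]/(c *: a) -[in leRHS](scale1r x) -(mulfV cn0) -scalerA.
  by rewrite -scalerBr enormZ gtr0_norm// ler_peMl// enorm_ge0.
exists (c *: b); split.
  by apply/nearestZ; rewrite // scalerA mulVf// scale1r.
move=> y /nearestZ => /(_ c0) /ub ->.
by rewrite scalerA mulfV// scale1r.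
Qed.

End curves.

(** * Speed and length of equivalent configurations *)

Section configs.
Variable R : realType.
Local Notation E := 'rV[R]_3.
Implicit Types (g h : R -> E) (c : R).

(* The Euclidean norms of the difference quotients of [h] and [g] agree up to
   the sign of the increment, so no chain rule is needed. *)
Lemma same_config_speed g h :
  (forall t, derivable g t 1) -> (forall t, derivable h t 1) ->
  same_config g h -> exists s, enorm (derive1 h 0) = enorm (derive1 g s).
Proof.
(* The parameter [0] of [h] corresponds to the parameter [(-1) ^+ e * 0 + a = a] of [g]. *)
move=> dg dh [Q [b [e [a [QQ _ hE]]]]]; exists a.
pose q (f : R -> E) (t k : R) : R := enorm (k^-1 *: (f (k *: 1 + t) - f t : E)).
have cq (f : R -> E) (t : R) :
      derivable f t 1 -> q f t k @[k --> 0^'] --> enorm (derive1 f t).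
  move=> df; rewrite derive1E.
  exact: (cvg_comp _ _ df (@enorm_continuous R _)).
pose sgn (k : R) : R := (-1) ^+ e * k.
have sg0 : sgn @ (0 : R)^' --> (0 : R)^'.
  rewrite /sgn.
  case: (e) => /=; last first.
    by rewrite (_ : (fun k : R => _) = id)//; apply/funext => k;
      rewrite expr0 mul1r.
  (* For a reflected parameter the increment changes sign; punctured neighbourhoods of [0] are
     stable under negation. *)
  have := dnbhsN (0 : R); rewrite oppr0 => dN P; rewrite {1}dN => -[P' P'0 <-].
  apply: (@filterS _ (0 : R)^' _ P') => // k P'k /=.
  by exists k => //; rewrite expr1 mulN1r.
(* The translation [b] cancels in the difference, [Q] preserves [enorm], and the sign of the
   increment disappears in the absolute value. *)
have qE k : q h 0 k = q g a (sgn k).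
  rewrite /q /sgn !enormZ !normfV normrMsign; congr (_ * _).
  have scale1 (x : R) : x *: (1 : R) = x by exact: mulr1.
  rewrite !scale1 !hE opprD addrACA subrr addr0 -mulmxBl enorm_isometry//.
  by rewrite mulr0 add0r addr0.
have := cq _ _ (dh 0); rewrite (funext qE) => qh.
have := cvg_comp _ _ sg0 (cq _ _ (dg a)) => qg.
exact: (cvg_unique _ qh qg).
Qed.

(** With constant speeds, agreement at one pair of parameters determines both lengths, so the
    integral needs no change of variables. *)
Lemma same_config_len g h :
  (forall t, derivable g t 1) -> (forall t, derivable h t 1) ->
  constant_speed g -> constant_speed h -> same_config g h -> len g = len h.
Proof.
move=> dg dh cg ch gh; have [s hs] := same_config_speed dg dh gh.
rewrite (len_constant_speed cg) (len_constant_speed ch) hs.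
by have [v gv] := cg; rewrite (gv 0) (gv s).
Qed.

Lemma same_configZ g h c :
  same_config g h -> same_config (c \*: g) (c \*: h).
Proof.
move=> [Q [b [e [a [QQ dQ hE]]]]]; exists Q, (c *: b), e, a; split=> // t /=.
by rewrite hE scalerDr scalemxAl.
Qed.

(** * Uniform convergence and scaling *)

Lemma cvg_uniform_distP (X : Type) (F : set_system X) {FF : Filter F}
    (G : X -> {uniform R -> E}) (g : {uniform R -> E}) :
  G x @[x --> F] --> g <->
  forall e, 0 < e -> \forall x \near F, forall t, `|g t - G x t| < e.
Proof.
split=> [Gg e e0|Gg P /uniform_nbhs[D []]].
  apply: (Gg [set f | forall t, `|g t - f t| < e]); apply/uniform_nbhs.
  exists [set xy | ball xy.1 e xy.2]; split.
    by rewrite -entourage_ballE; exists e.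
  by move=> f /= fe t; have := fe t Logic.I; rewrite -ball_normE.
rewrite -entourage_ballE => -[e /= e0 eD] DP.
near=> x; apply: DP => t _; apply: eD => /=; rewrite -ball_normE /ball_/=.
by move: t; near: x; exact: Gg.
Unshelve. all: by end_near. Qed.

Lemma continuous_uniform_eval (X : topologicalType) (G : X -> {uniform R -> E})
    (t : R) : continuous G -> continuous (fun x => G x t : E).
Proof.
move=> cG x; apply/cvgrPdist_lt => e e0.
by have /cvg_uniform_distP/(_ e e0) := cG x; apply: filterS => y; exact.
Qed.

(** If [G x] were unbounded, a small change of the scalar could move it arbitrarily far in the
    uniform topology. The bound [M] excludes this and is asked only at the limit point. *)
Lemma continuous_uniformZ (X : topologicalType) (a : X -> R)
    (G : X -> {uniform R -> E}) (x : X) (M : R) :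
  {for x, continuous a} -> {for x, continuous G} ->
  (forall t, `|G x t| <= M) ->
  {for x, continuous ((fun y => (a y \*: G y)) : X -> {uniform R -> E})}.
Proof.
move=> ca /cvg_uniform_distP cG bG; apply/cvg_uniform_distP => e e0.
have M0 : 0 <= M by apply: le_trans (bG 0).
have M1 : 0 < M + 1 by rewrite ltr_wpDl.
have N1 : 0 < `|a x| + 1 by rewrite ltr_wpDl.
near=> y => t /=.
have ay1 : `|a x - a y| < 1 by near: y; move/cvgrPdist_lt: ca; apply.
have aye : `|a x - a y| < e / 2 / (M + 1).
  by near: y; move/cvgrPdist_lt: ca; apply; rewrite !divr_gt0.
have Gye : `|G x t - G y t| < e / 2 / (`|a x| + 1).
  by move: t; near: y; apply: cG; rewrite !divr_gt0.
(* The error splits into the variation of the scalar against the bounded [G x], and the variation of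
   [G] against [a y], whose absolute value is at most [|a x| + 1]. *)
rewrite (_ : _ - _ = (a x - a y) *: G x t + a y *: (G x t - G y t)); last first.
  by rewrite scalerBl scalerBr addrA subrK.
rewrite (le_lt_trans (ler_normD _ _))// (splitr e) ltr_leD// !normrZ.
  rewrite ltr_pdivlMr// in aye; apply: le_lt_trans aye.
  by rewrite ler_wpM2l// (le_trans (bG t))// lerDl.
apply: ltW; rewrite ltr_pdivlMr// in Gye; rewrite mulrC; apply: le_lt_trans Gye.
rewrite ler_wpM2l//.
rewrite -[in leLHS](subKr (a x) (a y)) (le_trans (ler_normB _ _))//.
by rewrite lerD2l ltW.
Unshelve. all: by end_near. Qed.

End configs.

(** * Paths under a retraction, and subspace topologies *)

(** The end map [H (-, one)] pushes a path into [A] and keeps its ends, which already lie there.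
    Conversely, the inclusion carries paths of [A] to paths of [Y]. *)
Lemma strong_deformation_retract_path (R : realType) (Y : topologicalType)
    (A : set Y) (x y : A) : strong_deformation_retract R A ->
  inhabited {path unit_interval R from set_val x to set_val y in Y} <->
  inhabited {path unit_interval R from x to y in A}.
Proof.
move=> [H [cH H0 H1 HA]]; split=> -[p]; apply: inhabits.
  pose q (s : unit_interval R) : A :=
    exist _ (H (p s, one)) (mem_set (H1 (p s))).
  have cq : continuous q.
    apply: continuous_comp_initial => s.
    apply: (@continuous_comp _ _ _ (fun s => (p s, one)) H); last exact: cH.
    apply: (@cvg_pair _ _ _ (nbhs s) (nbhs (p s)) (nbhs one)).
      exact: cts_fun.
    exact: cvg_cst.
  have q0 : q zero = x.
    by apply: val_inj => /=; rewrite path_zero HA//; exact: set_valP.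
  have q1 : q one = y.
    by apply: val_inj => /=; rewrite path_one HA//; exact: set_valP.
  exact: (mk_path cq q0 q1).
have cp : continuous (set_val \o p).
  move=> s; apply: continuous_comp; first exact: cts_fun.
  exact: initial_continuous.
have p0 : (set_val \o p) zero = set_val x by rewrite /= path_zero.
have p1 : (set_val \o p) one = set_val y by rewrite /= path_one.
exact: (mk_path cp p0 p1).
Qed.

(** The image filter in [T] has a cluster point in [A]. It is also a cluster point in the subtype,
    because every neighbourhood there contains the trace of an open set of [T]. *)
Lemma compact_set_type (T : topologicalType) (A : set T) :
  compact A -> compact [set: A].
Proof.
move=> cA F FF _.
have FA : (set_val @ F) A.
  by apply: (@filterS _ F _ setT) => [u _|]; [exact: set_valP|exact: filterT].
have [p [Ap clp]] := cA _ (fmap_proper_filter set_val FF) FA.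
exists (exist _ p (mem_set Ap)); split=> // B C FB [_ /= [[W oW <-] Wp] WC].
have pW : nbhs p W by exact: open_nbhs_nbhs.
have [|_ [[x Bx <-] Wx]] := clp (set_val @` B) W _ pW.
  by apply: (@filterS _ F _ B) => // x Bx; exists x.
by exists x; split=> //; exact: WC.
Qed.

Lemma hausdorff_set_type (T : topologicalType) (A : set T) :
  hausdorff_space T -> hausdorff_space A.
Proof.
move=> hT p q clpq; apply: val_inj; apply: hT => B C pB qC.
have cA : continuous (set_val : A -> T) by exact: initial_continuous.
by have [x [Bx Cx]] := clpq _ _ (cA p _ pB) (cA q _ qC); exists (set_val x).
Qed.

Lemma unit_interval_locally_compact (R : realType) :
  locally_compact [set: unit_interval R].
Proof.
have cI : compact [set: unit_interval R].
  exact: compact_set_type (@segment_compact R 0 1).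
move=> x _; exists setT; first exact: filterT.
by split; [exact: cI|exact: closedT].
Qed.

(** * The stretching homotopy on thick curves *)

Section stretch.
Variables (R : realType) (K : set (set 'rV[R]_3)) (L : R).
Local Notation E := 'rV[R]_3.
Local Notation I := (unit_interval R).
Local Notation X := (thick_space K L).
Local Notation Y := (thick_configs K L).
Implicit Types (g h : X) (s : I).

Lemma thick_spaceP g : thick_curves K L (val g).
Proof. exact: set_valP. Qed.

(** Affine in time, so that the stretched length runs linearly from the original one to [L]; for a
    curve of length [L] the factor is constantly [1]. *)
Definition stretch_factor (z : X * I) : R :=
  1 - \val z.2 + \val z.2 * (L / len (val z.1)).

Lemma thick_space_len_gt0 g : 0 < len (val g).
Proof. by have [[cg sg] _ _ _] := thick_spaceP g; exact: len_gt0. Qed.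

(** A convex combination of [1] and [L / len], the latter at least [1] because lengths in [X] are at
    most [L]. This is what [reachZ_ge] asks for. *)
Lemma stretch_factor_ge1 z : 1 <= stretch_factor z.
Proof.
have [_ _ _ gL] := thick_spaceP z.1.
have /andP[s0 s1] := unit_interval_itv z.2.
have L1 : 1 <= L / len (val z.1).
  by rewrite ler_pdivlMr ?mul1r// thick_space_len_gt0.
by rewrite /stretch_factor; nra.
Qed.

Lemma stretch_factor_len z :
  stretch_factor z * len (val z.1) =
  (1 - \val z.2) * len (val z.1) + \val z.2 * L.
Proof.
by rewrite /stretch_factor mulrDl -mulrA divfK// gt_eqF// thick_space_len_gt0.
Qed.

Lemma stretch_factor_len_le z : stretch_factor z * len (val z.1) <= L.
Proof.
have [_ _ _ gL] := thick_spaceP z.1.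
have /andP[s0 s1] := unit_interval_itv z.2.
by rewrite stretch_factor_len; nra.
Qed.

Context (K_knot : knot_type K).

Lemma stretch_thick z :
  thick_curves K L (stretch_factor z \*: (val z.1 : R -> E)).
Proof.
have [[Cg sg] Kg tg lg] := thick_spaceP z.1.
have [_ dg _ _ _] := Cg.
have c1 := stretch_factor_ge1 z; have c0 := lt_le_trans ltr01 c1.
have rangeZ : range (stretch_factor z \*: (val z.1 : R -> E)) =
    [set stretch_factor z *: x | x in range (val z.1)].
  by rewrite image_comp.
split.
- by split; [exact: C11_embeddedZ|exact: constant_speedZ].
- by rewrite rangeZ; exact: knot_typeZ.
- by rewrite /thickness rangeZ (le_trans tg)// reachZ_ge.
- by rewrite lenZ ?stretch_factor_len_le// ltW.
Qed.

Definition stretch (z : X * I) : X :=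
  @exist _ (fun f => f \in thick_curves K L) _ (mem_set (stretch_thick z)).

Lemma thick_space_C1_jet_continuous :
  continuous (@C1_jet R (thick_curves K L) :
    X -> {uniform R -> E} * {uniform R -> E}).
Proof. exact: initial_continuous. Qed.

Lemma thick_space_val_continuous :
  continuous ((fun g => val g) : X -> {uniform R -> E}).
Proof.
move=> g; exact: (cvg_comp _ _ (@thick_space_C1_jet_continuous g) cvg_fst).
Qed.

Lemma thick_space_derive_continuous :
  continuous ((fun g => derive1 (val g)) : X -> {uniform R -> E}).
Proof.
move=> g; exact: (cvg_comp _ _ (@thick_space_C1_jet_continuous g) cvg_snd).
Qed.

Lemma thick_space_len_continuous : continuous (fun g : X => len (val g)).
Proof.
have -> : (fun g : X => len (val g)) =
    (fun g => enorm (derive1 (val g) 0) * (pi *+ 2)).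
  apply/funext => g; have [[_ sg] _ _ _] := thick_spaceP g.
  exact: len_constant_speed.
move=> g; apply: cvgMl; first exact: nbhs_filter.
have cd0 := continuous_uniform_eval (t := 0) thick_space_derive_continuous.
exact: (cvg_comp _ _ (cd0 g) (@enorm_continuous R _)).
Qed.

Lemma stretch_factor_continuous : continuous stretch_factor.
Proof.
move=> z.
have cs : \val y.2 @[y --> z] --> (\val z.2 : R).
  apply: (@continuous_comp _ _ _ snd (\val : I -> R)); first exact: cvg_snd.
  exact: initial_continuous.
apply: cvgD; first by apply: cvgB; [exact: cvg_cst|exact: cs].
apply: cvgM; first exact: cs.
apply: cvgMr; apply: cvgV; first by rewrite gt_eqF// thick_space_len_gt0.
apply: (@continuous_comp _ _ _ fst (fun g : X => len (val g))).
  exact: cvg_fst.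
exact: thick_space_len_continuous.
Qed.

(** The topology of [X] is initial for the jet, and the jet of a rescaled curve is the rescaled jet,
    so [continuous_uniformZ] applies to each component once it is bounded. *)
Lemma stretch_continuous : continuous stretch.
Proof.
have fstc (G : X -> {uniform R -> E}) : continuous G ->
    continuous (fun z : X * I => G z.1).
  move=> cG z; apply: (@continuous_comp _ _ _ fst G); first exact: cvg_fst.
  exact: cG.
apply: continuous_comp_initial => z.
have -> : @C1_jet R (thick_curves K L) \o stretch = fun z : X * I =>
   (stretch_factor z \*: (val z.1 : R -> E),
    stretch_factor z \*: derive1 (val z.1 : R -> E)).
  apply/funext => y; have [[[_ dg _ _ _] _] _ _ _] := thick_spaceP y.1.
  by rewrite /C1_jet/= derive1Z_curve.
have [[[[cg pg _] dg _ _ _] [v gv]] _ _ _] := thick_spaceP z.1.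
(* Periodicity bounds the curve; the constant speed [v] bounds its derivative below. *)
have [M gM] : exists M, forall t, `|val z.1 t| <= M.
  by apply: periodic_bounded cg pg; rewrite mulrn_wgt0// pi_gt0.
have cval : {for z, continuous ((fun y : X * I =>
    stretch_factor y \*: (val y.1 : R -> E)) : X * I -> {uniform R -> E})}.
  apply: (continuous_uniformZ (G := fun y : X * I => val y.1) (M := M)) => //.
    exact: stretch_factor_continuous.
  exact: (fstc _ thick_space_val_continuous).
have cder : {for z, continuous ((fun y : X * I =>
    stretch_factor y \*: derive1 (val y.1 : R -> E)) :
    X * I -> {uniform R -> E})}.
  apply: (continuous_uniformZ
    (G := fun y : X * I => derive1 (val y.1)) (M := v)).
  - exact: stretch_factor_continuous.
  - exact: (fstc _ thick_space_derive_continuous).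
  - by move=> t; rewrite -(gv t) norm_le_enorm.
exact: (cvg_pair cval cder).
Qed.

Lemma stretch_id z : stretch_factor z = 1 -> stretch z = z.1.
Proof.
move=> z1; apply: val_inj => /=; rewrite z1; apply/funext => t /=.
exact: scale1r.
Qed.

(** * Passage to configuration classes *)

Lemma config_class_eq g h :
  same_config (val g) (val h) -> config_class g = config_class h.
Proof. by move=> gh; apply/eqmodP/asboolP. Qed.

Lemma same_config_class g h :
  config_class g = config_class h -> same_config (val g) (val h).
Proof. by move=> /eqmodP/asboolP. Qed.

Lemma config_classP (y : Y) : exists g, y = config_class g.
Proof. by exists (repr y); rewrite /config_class reprK. Qed.

(** Equivalent curves have equal length, hence the same factor at time [s], and a common scaling
    respects equivalence. *)
Lemma stretch_same_config g h s : same_config (val g) (val h) ->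
  same_config (val (stretch (g, s))) (val (stretch (h, s))).
Proof.
move=> gh; have [[[_ dg _ _ _] sg] _ _ _] := thick_spaceP g.
have [[[_ dh _ _ _] sh] _ _ _] := thick_spaceP h.
rewrite /= /stretch_factor /= (same_config_len dg dh sg sh gh).
exact: same_configZ.
Qed.

(** The representative chosen by [repr] need not vary continuously; [stretch_configE] shows that the
    choice does not matter. *)
Definition stretch_config (z : Y * I) : Y :=
  config_class (stretch (repr z.1, z.2)).

Lemma stretch_configE g s :
  stretch_config (config_class g, s) = config_class (stretch (g, s)).
Proof.
apply/config_class_eq/stretch_same_config/same_config_class.
by rewrite /= /config_class reprK.
Qed.

(* A product of quotient maps need not be a quotient map; the compact-open
   adjunction applies because [I] is locally compact. *)
Lemma stretch_config_continuous : continuous stretch_config.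
Proof.
pose F z := config_class (stretch z).
have cF : continuous F.
  move=> z; apply: (@continuous_comp _ _ _ stretch (@config_class R K L)).
    exact: stretch_continuous.
  exact: pi_continuous.
have [cF1 cF2] := continuous_curry cF.
pose G : X -> {compact-open, I -> Y} := curry F.
have cG : continuous G by exact: cF1.
(* In curried form only the quotient variable remains in the domain, so the universal property of
   the quotient applies to [G]. *)
have -> : stretch_config = uncurry (G \o repr) by apply/funext => -[].
apply: continuous_uncurry.
- exact: unit_interval_locally_compact.
- exact: hausdorff_set_type (@Rhausdorff R).
(* Equivalent curves have the same trajectory of classes, so [G] descends. *)
- apply: (@repr_comp_continuous _ _ {compact-open, I -> Y} G cG) => g h /eqP gh.
  apply/eqP/funext => s; apply/config_class_eq/stretch_same_config.
  exact: same_config_class.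
- by move=> y; exact: cF2.
Qed.

End stretch.

Theorem proposition6p2 (R : realType) (K : set (set 'rV[R]_3))
    (K_knot : knot_type K) (L : R) (L_ge : (min_ropelength K <= L%:E)%E) :
  strong_deformation_retract R (length_shell K L) /\
  forall x y : length_shell K L,
    inhabited {path unit_interval R from set_val x to set_val y
               in thick_configs K L} <->
    inhabited {path unit_interval R from x to y in length_shell K L}.
Proof.
suff sdr : strong_deformation_retract R (length_shell K L).
  by split=> // x y; exact: strong_deformation_retract_path.
exists (stretch_config K_knot); split.
- exact: stretch_config_continuous.
- move=> y; have [g ->] := config_classP y.
  rewrite stretch_configE stretch_id//=.
  by rewrite /stretch_factor /= subr0 mul0r addr0.
- move=> y; have [g ->] := config_classP y; rewrite stretch_configE.
  exists (stretch K_knot (g, one)) => //=.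
  have [[[_ dg _ _ _] sg] _ _ _] := thick_spaceP g.
  have c0 := lt_le_trans ltr01 (stretch_factor_ge1 (g, one)).
  (* At time one the original length has weight zero and only [L] remains. *)
  by rewrite lenZ ?(ltW c0)// stretch_factor_len /= subrr mul0r add0r mul1r.
- move=> y s [g /= gL <-]; rewrite stretch_configE stretch_id//=.
  (* The value [L] is the length of a curve, hence positive, so [L / L] is [1] and not the default
     value [0] of a division by zero. *)
  have L0 : L != 0 by rewrite -gL gt_eqF// thick_space_len_gt0.
  by rewrite /stretch_factor /= gL divff// mulr1 subrK.
Qed.
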